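(* Let $\mathcal{O}\subset\mathbb{R}^n$ be open and bounded, and let $\beta:\mathbb{C}\to\mathbb{C}$ be strictly monotone and of at most linear growth, i.e. there is $c\in\mathbb{R}_+$ with $|\beta(z)|\le c(1+|z|)$ for all $z\in\mathbb{C}$. Let $V=\mathbb{L}^2(\mathcal{O};\mathbb{C})$, let $V^*=(\mathbb{L}^2)^*$ be its dual in the Gelfand triple $V\subset (H_0^1)^*\subset V^*$, let $J=-\Delta:V\to V^*$ be the (extended) Riesz/duality isomorphism, and let $A:=\Delta\beta:V\to V^*$, $A(\phi)=\Delta(\beta(\phi))$. Then the domain of $(J-A)^{-1}$ is the entire space $V^*$, i.e. for every $v\in V^*$ there exists $u\in V$ with $(J-A)(u)=v$ (or, equivalently, $-A$ is maximal monotone on $(V,V^* )$).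
   Context: On $\mathbb{C}^m$ the scalar product is $\langle z,z'\rangle=\sum_j\overline{z_j}z'_j$. A function $\beta:\mathbb{C}\to\mathbb{C}$ is monotone if there is $\alpha\ge 0$ with $\Re\langle\beta(z)-\beta(z'),z-z'\rangle_{\mathbb{C}}\ge\alpha|z-z'|^2$ for all $z,z'\in\mathbb{C}$; it is strictly monotone if this holds with some $\alpha>0$. $\mathbb{L}^2$ is the space of complex-valued square-integrable functions on $\mathcal{O}$ with $\langle\phi,\psi\rangle_{\mathbb{L}^2}=\int_{\mathcal{O}}\overline{\phi}\psi\,d\xi$. $H_0^1$ is the space of complex-valued functions on $\mathcal{O}$ whose real and imaginary parts lie in the classical Sobolev space $H_0^{1,2}(\mathcal{O};\mathbb{R})$ (Dirichlet boundary conditions), with $\langle\phi,\psi\rangle_{H_0^1}=\int_{\mathcal{O}}\langle\nabla\phi,\nabla\psi\rangle_{\mathbb{C}^n}d\xi$. $(H_0^1)^*$ is its dual; $-\Delta:H_0^1\to(H_0^1)^*$ is an isometric isomorphism and $\langle\Delta\phi,\Delta\psi\rangle_{(H_0^1)^*}=\langle\phi,\psi\rangle_{H_0^1}$. Gelfand triple: identifying $(H_0^1)^*$ with its own dual $H_0^1$ via $(-\Delta)^{-1}$ (so $(H_0^1)^*$ is the pivot space), one has $V:=\mathbb{L}^2\subset(H_0^1)^*\subset V^*=(\mathbb{L}^2)^*$. Here $V^*$ is the dual of $\mathbb{L}^2$ with respect to the $(H_0^1)^*$ pivot. The operator $-\Delta$ extends to a surjective isometry $V\to V^*$ with $\langle-\Delta\phi,\psi\rangle_{V^*,V}=\langle\phi,\psi\rangle_{\mathbb{L}^2}$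 for all $\phi,\psi\in V$. An operator $B:D(B)\subset V\to V^*$ is monotone if there is $\alpha\ge0$ such that $\Re\langle B(h)-B(h'),h-h'\rangle_{V^*,V}\ge\alpha\|h-h'\|_V^2$ for all $h,h'\in D(B)$. It is maximal monotone if its graph is not properly contained in the graph of another (possibly multivalued) operator from $V$ to $V^*$ that is monotone for the pairing $\Re\langle\cdot,\cdot\rangle_{V^*,V}$.
   Formalization: The function β is additionally assumed continuous; without this the claim fails, e.g. β(z) = z + sgn(Re z) is strictly monotone of linear growth, but (J−A)(u) = J(1/2) has no solution when the open set is nonempty and n ≥ 1. *)

(* Defs.v *)
From HB Require Import structures.
From mathcomp Require Import all_boot all_order all_algebra.
From mathcomp Require Import complex.
From mathcomp Require Import all_classical all_reals all_analysis.
From mathcomp Require Import measurable_realfun.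
Import Order.TTheory GRing.Theory Num.Theory.
Import numFieldNormedType.Exports.
Set Implicit Arguments.
Unset Strict Implicit.
Unset Printing Implicit Defensive.
Local Open Scope classical_set_scope.
Local Open Scope ring_scope.

(* The spaces [H_0^1] and [L^2] are made of functions on the whole of ['rV[R]_n]
   of which only the values on the open set [O] matter; [L^2] and [H_0^1] are
   not quotiented by equality almost everywhere.  Elements of a dual are
   functionals on functions, compared on the space only; a functional bounded
   for the [L^2] norm does not see null sets.
   Scalar products are conjugate-linear in the first argument, so that the
   pairing <v, psi> of a functional v with psi is [v psi], linear in psi.      *)

Definition rV_display : measure_display. Proof. exact: default_measure_display. Qed.

(* The product of the Borel sigma-algebras of the coordinates. *)
Section rV_measurable.
Context {R : realType} {n : nat}.

Let coors (i : 'I_n) (x : 'rV[R]_n) : measurableTypeR R := x ord0 i.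

HB.instance Definition _ := @isMeasurable.Build rV_display 'rV[R]_n
  (g_sigma_preimage coors) (@sigma_algebra0 _ _ _) (@sigma_algebraC _ _ )
  (@sigma_algebra_bigcup _ _ _).

Lemma measurable_coord (i : 'I_n) :
  measurable_fun setT (fun x : 'rV[R]_n => x ord0 i).
Proof.
move=> _ Y mY; rewrite setTI; apply: sub_sigma_algebra => /=.
rewrite -bigcup_seq/=; exists i => /=; first by rewrite mem_index_enum.
by exists Y => //; rewrite setTI.
Qed.

Lemma measurable_fun_rVP d (T : measurableType d) (f : T -> 'rV[R]_n) :
  (forall i, measurable_fun setT (fun t => f t ord0 i)) ->
  measurable_fun setT f.
Proof.
move=> mf; apply: (measurability
  (\big[setU/set0]_(i < n) preimage_set_system setT (coors i) measurable)) => //.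
move=> _ [B + <-]; rewrite -bigcup_seq => -[i /= _ [A mA <-]].
by rewrite setTI; exact: mf.
Qed.

End rV_measurable.

Section lebesgue_rV.
Context {R : realType}.

Definition rV_cons n (p : R * 'rV[R]_n) : 'rV[R]_n.+1 :=
  \row_i if unlift ord0 i is Some j then p.2 ord0 j else p.1.

Definition rV_uncons n (x : 'rV[R]_n.+1) : R * 'rV[R]_n :=
  (x ord0 ord0, \row_j x ord0 (lift ord0 j)).

Lemma rV_consK n : cancel (@rV_cons n) (@rV_uncons n).
Proof.
case=> a y; rewrite /rV_uncons /rV_cons mxE unlift_none/=; congr pair.
by apply/rowP => j; rewrite !mxE liftK.
Qed.

Lemma rV_unconsK n : cancel (@rV_uncons n) (@rV_cons n).
Proof.
move=> x; apply/rowP => i; rewrite mxE.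
by case: unliftP => [j ->|->]; rewrite //= mxE.
Qed.

Lemma measurable_rV_cons n : measurable_fun setT (@rV_cons n).
Proof.
apply: measurable_fun_rVP => i.
case: (unliftP ord0 i) => [j ij|i0].
  rewrite (_ : (fun _ => _) = (fun y : 'rV[R]_n => y ord0 j) \o snd); last first.
    by apply/funext => p; rewrite mxE ij liftK.
  by apply: measurableT_comp => //; exact: measurable_coord.
rewrite (_ : (fun _ => _) = fst) //.
by apply/funext => p; rewrite mxE i0 unlift_none.
Qed.

Lemma measurable_rV_uncons n : measurable_fun setT (@rV_uncons n).
Proof.
apply/measurable_fun_pairP; split => /=; first exact: measurable_coord.
apply: measurable_fun_rVP => i.
rewrite (_ : (fun _ => _) = fun x : 'rV[R]_n.+1 => x ord0 (lift ord0 i)).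
  exact: measurable_coord.
by apply/funext => x; rewrite mxE.
Qed.

Section step.
Variables (n : nat) (m : {sigma_finite_measure set 'rV[R]_n -> \bar R}).
Local Open Scope ereal_scope.

Definition leb_step : set 'rV[R]_n.+1 -> \bar R :=
  pushforward ((@lebesgue_measure R) \x m) (@rV_cons n).


Let mcons : measurable_fun setT (@rV_cons n) := @measurable_rV_cons n.

Let leb_step0 : leb_step set0 = 0.
Proof. exact: measure0. Qed.

Let leb_step_ge0 A : 0 <= leb_step A.
Proof. exact: measure_ge0. Qed.

Let leb_step_sigma_additive : semi_sigma_additive leb_step.
Proof. exact: measure_semi_sigma_additive. Qed.

HB.instance Definition _ := isMeasure.Build _ _ _ leb_step
  leb_step0 leb_step_ge0 leb_step_sigma_additive.

Let leb_step_sigma_finite : sigma_finite setT leb_step.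
Proof.
have /sigma_finiteP[F [TF ndF Foo]] := sigma_finiteT (@lebesgue_measure R).
have /sigma_finiteP[G [TG ndG Goo]] := sigma_finiteT m.
exists (fun k => @rV_uncons n @^-1` (F k `*` G k)).
  apply/esym/seteqP; split => // x _.
  have [k _ Fk] : (\bigcup_k F k) (x ord0 ord0) by rewrite -TF.
  have [l _ Gl] : (\bigcup_k G k) (rV_uncons x).2 by rewrite -TG.
  exists (maxn k l) => //; split.
    by move: Fk; apply/subsetPset/ndF/leq_maxl.
  by move: Gl; apply/subsetPset/ndG/leq_maxr.
move=> k; have [mF Fk] := Foo k; have [mG Gk] := Goo k; split.
  rewrite -[X in measurable X]setTI; apply: measurable_rV_uncons => //.
  exact: measurableX.
rewrite /leb_step /pushforward (_ : _ @^-1` _ = F k `*` G k); last first.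
  rewrite -comp_preimage (_ : _ \o _ = id) ?preimage_id//.
  by apply/funext => p; rewrite /comp rV_consK.
by rewrite product_measure1E// lte_mul_pinfty// ge0_fin_numE.
Qed.

HB.instance Definition _ := Measure_isSigmaFinite.Build _ _ _ leb_step
  leb_step_sigma_finite.

End step.

(* Lebesgue measure on R^n, as an iterated product; it is characterized by
   [lebesgue_rV_box]. *)
Fixpoint lebesgue_rV n : {sigma_finite_measure set 'rV[R]_n -> \bar R} :=
  if n is n'.+1 then leb_step (lebesgue_rV n') else \d_(0 : 'rV[R]_0).

Lemma lebesgue_rV_box n (a b : 'rV[R]_n) : (forall i, a ord0 i <= b ord0 i) ->
  lebesgue_rV n [set x : 'rV[R]_n | forall i, x ord0 i \in `[a ord0 i, b ord0 i]] =
  (\prod_(i < n) (b ord0 i - a ord0 i))%:E.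
Proof.
elim: n a b => [|n IHn] a b ab.
  rewrite big_ord0 /= diracE mem_set//= => -[].
  by move=> ? [].
rewrite /= /leb_step /pushforward.
pose a' : 'rV[R]_n := \row_j a ord0 (lift ord0 j).
pose b' : 'rV[R]_n := \row_j b ord0 (lift ord0 j).
transitivity ((lebesgue_measure \x lebesgue_rV n)%E (`[a ord0 ord0, b ord0 ord0]
    `*` [set x : 'rV[R]_n | forall i, x ord0 i \in `[a' ord0 i, b' ord0 i]])).
  congr (product_measure1 _ _ _).
  apply/seteqP; split => -[x y] /=.
    move=> xy; split.
      by have := xy ord0; rewrite mxE unlift_none.
    by move=> i; have := xy (lift ord0 i); rewrite !mxE liftK.
  case=> xab yab i; rewrite mxE; case: unliftP => [j ->|->] //=.
  by have := yab j; rewrite !mxE.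
rewrite product_measure1E//; last first.
  rewrite (_ : [set x | _] = \bigcap_(i in [set: 'I_n])
      ((fun x : 'rV[R]_n => x ord0 i) @^-1` `[a' ord0 i, b' ord0 i])).
    apply: fin_bigcap_measurable => // i _.
    by rewrite -[X in measurable X]setTI; exact: measurable_coord.
  by apply/seteqP; split => x /= h i; [move=> _; exact: h|exact: (h i)].
rewrite IHn; last by move=> i; rewrite !mxE.
have leb1 : lebesgue_measure `[a ord0 ord0, b ord0 ord0] =
    (b ord0 ord0 - a ord0 ord0)%:E.
  rewrite lebesgue_measure_itv/= lte_fin -EFinB.
  have := ab ord0; rewrite le_eqVlt; case: ltP => // _ /orP[/eqP->|//].
  by rewrite subrr.
rewrite big_ord_recl EFinM; apply: congr2; first exact: leb1.
rewrite (_ : \prod_(i < n) (b' ord0 i - a' ord0 i) =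
  \prod_(i < n) (b ord0 (lift ord0 i) - a ord0 (lift ord0 i))); last first.
  by apply: eq_bigr => i _; rewrite !mxE.
by [].
Qed.

End lebesgue_rV.

Lemma open_measurable_rV (R : realType) n (A : set 'rV[R]_n) :
  open A -> measurable A.
Proof.
move=> oA.
pose B (q : 'rV[rat]_n * nat) : set 'rV[R]_n :=
  ball (map_mx ratr q.1 : 'rV[R]_n) q.2.+1%:R^-1.
have mB q : measurable (B q).
  rewrite (_ : B q = \bigcap_(i in [set: 'I_n]) ((fun x : 'rV[R]_n => x ord0 i)
      @^-1` ball (ratr (q.1 ord0 i) : R) q.2.+1%:R^-1)).
    apply: fin_bigcap_measurable => // i _.
    rewrite -[X in measurable X]setTI; apply: measurable_coord => //.
    exact: measurable_ball.
  apply/seteqP; split => x.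
    by case=> _ Bx i _ /=; have := Bx ord0 i; rewrite mxE.
  by move=> Bx; split=> // i j; rewrite ord1 mxE; exact: (Bx j I).
rewrite (_ : A = \bigcup_(q in [set q | B q `<=` A]) B q).
  rewrite bigcup_mkcond; apply: countable_bigcupT_measurable => [|q].
    exact: countableP.
  by case: ifP.
apply/seteqP; split; last by apply: bigcup_sub => q.
move=> x Ax; have /nbhs_ballP[e /= e0 xeA] : nbhs x A by exact: open_nbhs_nbhs.
have [k ke] : exists k, k.+1%:R^-1 < e / 2 :> R.
  have e2 : 0 < e / 2 by rewrite divr_gt0.
  by have [k _ /(_ _ (leqnn k))] := near_infty_natSinv_lt (PosNum e2); exists k.
have xq i : exists q, ball (x ord0 i) k.+1%:R^-1 (ratr q : R).
  have [|z [xz [q _ qz]]] := @dense_rat R (ball (x ord0 i) k.+1%:R^-1) _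
    (ball_open _ _); last by exists q; rewrite qz.
  by exists (x ord0 i); apply: ballxx; rewrite invr_gt0.
have [q xqE] := choice xq.
exists (\row_i q i, k) => /=.
  move=> y [_ /= yB]; apply: xeA; split=> // i j.
  rewrite ord1 (splitr e); apply: (@ball_triangle _ _ (ratr (q j) : R)).
    by apply: le_ball (xqE j); exact: ltW.
  by have := yB ord0 j; rewrite !mxE; apply: le_ball; exact: ltW.
by split=> // i j; rewrite ord1 !mxE; exact/ball_sym.
Qed.

Section complex_functions.
Context {R : realType}.

Definition cdot (z w : R[i]) : R[i] := z^*%C * w.

Definition strictly_monotone (beta : R[i] -> R[i]) :=
  exists2 alpha : R, 0 < alpha & forall z w,
    alpha * Normc.normc (z - w) ^+ 2 <= complex.Re (cdot (beta z - beta w) (z - w)).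

Definition linear_growth (beta : R[i] -> R[i]) :=
  exists2 c : R, 0 <= c &
    forall z, Normc.normc (beta z) <= c * (1 + Normc.normc z).

End complex_functions.

Section spaces.
Context {R : realType} {n : nat} (O : set 'rV[R]_n).
Local Notation fct := ('rV[R]_n -> R[i]).
Local Notation functional := (fct -> R[i]).
Local Notation mu := (lebesgue_rV n).

Definition cintegral (f : fct) : R[i] :=
  ((\int[mu]_(x in O) complex.Re (f x)) +i*
   (\int[mu]_(x in O) complex.Im (f x)))%C.

Definition L2 : set fct := [set f : fct |
  [/\ measurable_fun O (fun x => complex.Re (f x)),
      measurable_fun O (fun x => complex.Im (f x)) &
      (\int[mu]_(x in O) (Normc.normc (f x) ^+ 2)%:E < +oo)%E]].

Definition L2_dot (f g : fct) : R[i] := cintegral (fun x => cdot (f x) (g x)).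

Definition L2_norm (f : fct) : R :=
  Num.sqrt (\int[mu]_(x in O) Normc.normc (f x) ^+ 2).

Definition L2_dual : set functional := [set v |
  (forall (a : R[i]) f g, L2 f -> L2 g ->
     v (fun x => a * f x + g x) = a * v f + v g) /\
  (exists M : R, forall f, L2 f -> Normc.normc (v f) <= M * L2_norm f)].

Definition iter_partial (s : seq 'I_n) (f : 'rV[R]_n -> R) : 'rV[R]_n -> R :=
  foldr (fun i g => 'D_('e_i) g) f s.

Definition smooth (f : 'rV[R]_n -> R) := forall s : seq 'I_n,
  continuous (iter_partial s f) /\
  forall i x, derivable (iter_partial s f) x 'e_i.

Definition test_function (f : 'rV[R]_n -> R) :=
  smooth f /\
  exists K : set 'rV[R]_n, [/\ compact K, K `<=` O & forall x, ~ K x -> f x = 0].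

Definition sq_integrable (f : 'rV[R]_n -> R) :=
  measurable_fun O f /\ (\int[mu]_(x in O) (f x ^+ 2)%:E < +oo)%E.

(* [u] belongs to the closure of the test functions in the Sobolev space
   H^{1,2}(O; R), and [g] is its weak gradient. *)
Definition H10_real (u : 'rV[R]_n -> R) (g : 'I_n -> 'rV[R]_n -> R) :=
  [/\ sq_integrable u, forall i, sq_integrable (g i) &
    exists f : nat -> 'rV[R]_n -> R, [/\ forall k, test_function (f k),
      (fun k => \int[mu]_(x in O) ((f k x - u x) ^+ 2)%:E)%E @ \oo --> 0%E &
      forall i, (fun k => \int[mu]_(x in O) (('D_('e_i) (f k) x - g i x) ^+ 2)%:E)%E
        @ \oo --> 0%E]].

Definition H10_grad (phi : fct) (G : 'I_n -> fct) :=
  H10_real (fun x => complex.Re (phi x)) (fun i x => complex.Re (G i x)) /\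
  H10_real (fun x => complex.Im (phi x)) (fun i x => complex.Im (G i x)).

Definition H10 : set fct := [set phi | exists G, H10_grad phi G].

Definition grad (phi : fct) : 'I_n -> fct :=
  xget (fun _ _ => 0) [set G | H10_grad phi G].

Definition H10_dot (phi psi : fct) : R[i] :=
  cintegral (fun x => \sum_(i < n) cdot (grad phi i x) (grad psi i x)).

(* The element [- Delta phi] of the dual of H_0^1, for [phi] in H_0^1. *)
Definition neg_laplacian (phi : fct) : functional := H10_dot phi.

(* [c] is the scalar product of [f] and [g] in the dual of H_0^1, i.e.
   <- Delta phi, - Delta psi> = <phi, psi>_{H_0^1}. *)
Definition H10_dual_dot (f g : functional) (c : R[i]) :=
  exists phi psi, [/\ H10 phi, H10 psi,
    forall eta, H10 eta -> f eta = neg_laplacian phi eta,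
    forall eta, H10 eta -> g eta = neg_laplacian psi eta & c = H10_dot phi psi].

(* [J] is the operator [- Delta] from V = L^2 to V^* = [L2_dual] in the Gelfand
   triple with pivot the dual of H_0^1, in which
   - [psi] in L^2 is the functional [L2_dot psi] on H_0^1;
   - [f] in the pivot space is the functional on V that sends [psi] to the
     scalar product of [f] and [psi] in the dual of H_0^1.
   The second field is the identity that extends [- Delta] from H_0^1 to L^2;
   it determines [J], and [L2_dot] is such an operator
   ([extended_neg_laplacian_L2_dot]). *)
Record extended_neg_laplacian (J : fct -> functional) : Prop := {
  neg_laplacian_H10 : forall phi psi c, H10 phi -> L2 psi ->
    H10_dual_dot (neg_laplacian phi) (L2_dot psi) c -> J phi psi = c;
  neg_laplacian_L2 : forall phi psi, L2 phi -> L2 psi ->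
    J phi psi = L2_dot phi psi
}.

Definition operator_graph (B : fct -> functional) : set (fct * functional) :=
  [set p | [/\ L2 p.1, L2_dual p.2 & forall psi, L2 psi -> p.2 psi = B p.1 psi]].

Definition monotone_graph (T : set (fct * functional)) :=
  exists2 alpha : R, 0 <= alpha & forall p q, T p -> T q ->
    let h := fun x => p.1 x - q.1 x in
    alpha * L2_norm h ^+ 2 <= complex.Re (p.2 h - q.2 h).

Definition maximal_monotone (B : fct -> functional) :=
  monotone_graph (operator_graph B) /\
  forall T : set (fct * functional), T `<=` L2 `*` L2_dual ->
    monotone_graph T -> ~ (operator_graph B `<` T).

Let RintegralN_ (f : 'rV[R]_n -> R) :
  \int[mu]_(x in O) (- f x) = - \int[mu]_(x in O) f x.
Proof.
rewrite /Rintegral (eq_integral (\- (EFin \o f))%E)//.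
rewrite integralE [in RHS]integralE funeposN funenegN.
set a := (\int[mu]_(x in O) (_^\-)%E x)%E.
set b := (\int[mu]_(x in O) (_^\+)%E x)%E.
have : (0 <= a)%E by exact: integral_ge0.
have : (0 <= b)%E by exact: integral_ge0.
by case: a b => [a| |] [b| |]//= _ _; rewrite ?oppr0// opprB.
Qed.

Lemma cintegral_conj (f : fct) : cintegral (fun x => (f x)^*%C) = (cintegral f)^*%C.
Proof.
rewrite /cintegral; apply/eqP; rewrite eq_complex /=; apply/andP; split; apply/eqP.
  by congr (Rintegral _ _ _); apply/funext => x; case: (f x).
rewrite (_ : (fun x => _) = fun x => - complex.Im (f x)); last first.
  by apply/funext => x; case: (f x).
by rewrite RintegralN_.
Qed.

Lemma cdotC (z w : R[i]) : cdot z w = (cdot w z)^*%C.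
Proof. by rewrite /cdot rmorphM/= conjcK mulrC. Qed.

Lemma L2_dotC f g : L2_dot f g = (L2_dot g f)^*%C.
Proof.
rewrite /L2_dot -cintegral_conj; congr cintegral.
by apply/funext => x; exact: cdotC.
Qed.

Lemma H10_dotC f g : H10_dot f g = (H10_dot g f)^*%C.
Proof.
rewrite /H10_dot -cintegral_conj; congr cintegral.
apply/funext => x; rewrite rmorph_sum; apply: eq_bigr => i _; exact: cdotC.
Qed.

Lemma extended_neg_laplacian_L2_dot : extended_neg_laplacian L2_dot.
Proof.
split => // phi psi c Hphi _ [phi' [w [Hphi' Hw phiE wE ->]]].
rewrite L2_dotC wE// /neg_laplacian -H10_dotC.
exact: phiE.
Qed.

End spaces.

(* Main.v *)
(* On L^2 the operator J is the pairing phi |-> <phi, .>, so J - A sends u to the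
   functional <u + beta u, .>, and every functional on L^2 is <f, .> by Riesz'
   theorem.  It remains to solve u + beta u = f pointwise: id + beta is a
   bijection of C whose inverse is nonexpansive, hence maps L^2 to L^2.
   For maximality (Minty's argument), let (phi, <f, .>) be monotonically related
   to the graph of -A; solving u + beta u = f + phi and testing against
   (u, <beta u, .>) gives - |phi - u|^2 >= 0, so phi = u a.e. and f = beta phi. *)
Require Import Defs.
From HB Require Import structures.
From mathcomp Require Import all_boot all_order all_algebra.
From mathcomp Require Import complex.
From mathcomp Require Import all_classical all_reals all_analysis.
From mathcomp Require Import measurable_realfun.
From mathcomp Require Import ring lra.
Import Order.TTheory GRing.Theory Num.Theory.
Import numFieldNormedType.Exports.
Local Open Scope classical_set_scope.
Local Open Scope ring_scope.

(** Solving pointwise replaces an abstract surjectivity theorem for monotone operators on [L2] by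
    one on the plane. There neither degree theory nor a fixed point is needed: a strongly monotone
    pair of real equations is solved by the intermediate value theorem, one unknown at a time. The
    price is that the pointwise solution must again lie in [L2]. Its measurability comes from
    continuity of the inverse of [id + beta], its integrability from linear growth and the finite
    measure of the bounded set [O]. Continuity of [beta] serves both the intermediate value theorem
    and the measurability of [beta (f x)]. Since [L2] consists of functions rather than classes,
    Riesz' theorem is proved directly on representatives: first for real functions, where the
    functional to minimize is real-valued, then for complex ones. *)

(** * Surjectivity of strongly monotone maps of the line and of the plane *)

Section strongly_monotone_maps.
Context {R : realType}.

Lemma strongly_monotone_line_surj (h : R -> R) (a : R) : 0 < a ->
  continuous h -> (forall x y, a * (x - y) ^+ 2 <= (h x - h y) * (x - y)) ->
  forall w, exists x, h x = w.
Proof.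
(* Strong monotonicity between [0] and [r] or [- r] moves [h] by at least [a * r], which must reach
   [w]. The [+ 1] keeps [r] positive even if [h 0 = w], so that one can divide by [r]. *)
move=> a0 ch mh w; pose r := `|h 0 - w| / a + 1.
have r0 : 0 < r by rewrite ltr_pwDr// divr_ge0// ltW.
have ar : `|h 0 - w| <= a * r.
  by rewrite /r mulrDr mulr1 mulrCA mulfV ?gt_eqF// mulr1 lerDl ltW.
have hr : h 0 + a * r <= h r.
  have := mh r 0; rewrite subr0 expr2 mulrA ler_pM2r//; lra.
have hNr : h (- r) <= h 0 - a * r.
  have := mh 0 (- r); rewrite sub0r opprK expr2 mulrA ler_pM2r//; lra.
move: ar; rewrite ler_norml => /andP[ar1 ar2].
have [|||c _ hc] := @IVT R h (- r) r w.
- lra.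
- exact: continuous_subspaceT.
- by rewrite ge_min le_max; apply/andP; split; apply/orP; [left|right]; lra.
- by exists c.
Qed.

(* Elimination of the first coordinate, as in a Schur complement: solving
   [P x y = w1] for [x = g y] leaves the function [y |-> Q (g y) y], which
   is again strongly monotone. *)
Lemma strongly_monotone_plane_surj (P Q : R -> R -> R) (a : R) : 0 < a ->
  continuous (fun p : R * R => P p.1 p.2) ->
  continuous (fun p : R * R => Q p.1 p.2) ->
  (forall x y x' y', a * ((x - x') ^+ 2 + (y - y') ^+ 2) <=
     (P x y - P x' y') * (x - x') + (Q x y - Q x' y') * (y - y')) ->
  forall w1 w2, exists x y, P x y = w1 /\ Q x y = w2.
Proof.
move=> a0 cP cQ mPQ w1 w2.
have cPx y : continuous (P ^~ y).
  move=> x; apply: (@continuous_comp _ _ _ (fun x => (x, y))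
    (fun p : R * R => P p.1 p.2)); last exact: cP.
  exact: (cvg_pair cvg_id (cvg_cst _)).
have cPy x : continuous (P x).
  move=> y; apply: (@continuous_comp _ _ _ (fun y => (x, y))
    (fun p : R * R => P p.1 p.2)); last exact: cP.
  exact: (cvg_pair (cvg_cst _) cvg_id).
have mPx y x x' : a * (x - x') ^+ 2 <= (P x y - P x' y) * (x - x').
  by have := mPQ x y x' y; rewrite subrr expr0n/= mulr0 !addr0.
have /choice[g Pg] : forall y, exists x, P x y = w1.
  by move=> y; exact: (@strongly_monotone_line_surj (P ^~ y) a).
(* This yields continuity of [g]: as [y] tends to [y'], [P (g y') y] tends to [P (g y') y' = w1]. *)
have gP y y' : a * `|g y - g y'| <= `|w1 - P (g y') y|.
  have [->|d0] := eqVneq (g y) (g y'); first by rewrite subrr normr0 mulr0.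
  rewrite -(@ler_pM2r _ `|g y - g y'|) ?normr_gt0 ?subr_eq0//.
  rewrite -mulrA -expr2 real_normK ?num_real// -normrM -{1}(Pg y).
  by rewrite (le_trans (mPx y _ _))// ler_norm.
have cg : continuous g.
  move=> y; apply/cvgrPdist_lt => e e0.
  have ae : 0 < a * e by rewrite mulr_gt0.
  have /cvgrPdist_lt/(_ _ ae) := cPy (g y) y.
  apply: filterS => z; rewrite (Pg y) => Pz.
  by rewrite distrC -(ltr_pM2l a0) (le_lt_trans (gP _ _)).
pose h y := Q (g y) y.
have ch : continuous h.
  move=> y; apply: (@continuous_comp _ _ _ (fun y => (g y, y))
    (fun p : R * R => Q p.1 p.2)); last exact: cQ.
  exact: (cvg_pair (cg y) cvg_id).
have mh y y' : a * (y - y') ^+ 2 <= (h y - h y') * (y - y').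
  have := mPQ (g y) y (g y') y'; rewrite !Pg subrr mul0r add0r.
  by apply: le_trans; rewrite ler_pM2l// lerDr sqr_ge0.
by have [y hy] := strongly_monotone_line_surj h a a0 ch mh w2; exists (g y), y.
Qed.

Lemma sqr_normc_ReIm (z : R[i]) :
  Normc.normc z ^+ 2 = complex.Re z ^+ 2 + complex.Im z ^+ 2.
Proof. by case: z => x y; rewrite /= sqr_sqrtr// addr_ge0// sqr_ge0. Qed.

Lemma normc_ge0 (z : R[i]) : 0 <= Normc.normc z.
Proof. by case: z => x y; exact: sqrtr_ge0. Qed.

Lemma Re_cdotE (z w : R[i]) : complex.Re (cdot z w) =
  complex.Re z * complex.Re w + complex.Im z * complex.Im w.
Proof. by case: z w => [x y] [x' y']; rewrite /cdot/= mulNr opprK. Qed.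

Lemma Im_cdotE (z w : R[i]) : complex.Im (cdot z w) =
  complex.Re z * complex.Im w - complex.Im z * complex.Re w.
Proof. by case: z w => [x y] [x' y']; rewrite /cdot/= mulNr. Qed.

Lemma Re_cdot_le (z w : R[i]) :
  complex.Re (cdot z w) <= Normc.normc z * Normc.normc w.
Proof.
case: z w => [x y] [x' y']; rewrite Re_cdotE/=.
rewrite -sqrtrM ?addr_ge0 ?sqr_ge0//.
rewrite (le_trans (ler_norm _))// -sqrtr_sqr ler_wsqrtr//.
(* Lagrange's identity: this square is the gap between the two sides. *)
have := sqr_ge0 (x * y' - y * x'); lra.
Qed.

Lemma normr_Re_le_normc (z : R[i]) : `|complex.Re z| <= Normc.normc z.
Proof.
by case: z => x y; rewrite -sqrtr_sqr/= ler_wsqrtr// lerDl sqr_ge0.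
Qed.

Lemma normr_Im_le_normc (z : R[i]) : `|complex.Im z| <= Normc.normc z.
Proof.
by case: z => x y; rewrite -sqrtr_sqr/= ler_wsqrtr// lerDr sqr_ge0.
Qed.

Lemma normc_le (z : R[i]) :
  Normc.normc z <= `|complex.Re z| + `|complex.Im z|.
Proof.
case: z => x y; rewrite /= -(@ler_pXn2r _ 2) ?nnegrE ?sqrtr_ge0 ?addr_ge0//.
rewrite sqr_sqrtr ?addr_ge0 ?sqr_ge0// sqrrD !real_normK ?num_real//.
by rewrite lerD2r lerDl mulrn_wge0// mulr_ge0.
Qed.

Lemma ReB (z w : R[i]) : complex.Re (z - w) = complex.Re z - complex.Re w.
Proof. by case: z w => [? ?] [? ?]. Qed.

Lemma ImB (z w : R[i]) : complex.Im (z - w) = complex.Im z - complex.Im w.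
Proof. by case: z w => [? ?] [? ?]. Qed.

Lemma ReD (z w : R[i]) : complex.Re (z + w) = complex.Re z + complex.Re w.
Proof. by case: z w => [? ?] [? ?]. Qed.

Lemma ImD (z w : R[i]) : complex.Im (z + w) = complex.Im z + complex.Im w.
Proof. by case: z w => [? ?] [? ?]. Qed.

Lemma continuous_mkcomplex :
  continuous ((fun p : R * R => Complex p.1 p.2) : R * R -> R[i]^o).
Proof.
move=> [x y]; apply/cvgrPdist_lt => /= -[e e'].
(* Radii of balls in [R[i]^o] are complex numbers; being positive forces the imaginary part to
   vanish. *)
rewrite ltcE/= => /andP[/eqP -> {e'} e0].
have e2 : 0 < e / 2 by rewrite divr_gt0.
have xe := nbhsx_ballx x _ e2; have ye := nbhsx_ballx y _ e2.
exists (ball x (e / 2), ball y (e / 2)) => //= -[x' y'] [/= + +].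
rewrite /ball/= => xx' yy'.
rewrite ltcR -(@ltr_pXn2r _ 2) ?nnegrE ?sqrtr_ge0// 1?ltW//.
rewrite sqr_sqrtr ?addr_ge0 ?sqr_ge0//.
have le t : `|t| < e / 2 -> t ^+ 2 < (e / 2) ^+ 2.
  by move=> te; rewrite -real_normK ?num_real// ltr_pXn2r ?nnegrE// ltW.
by have := le _ xx'; have := le _ yy'; nra.
Qed.

Lemma continuous_Re : continuous (@complex.Re R : R[i]^o -> R).
Proof.
move=> z; apply/(@cvgrPdist_lt _ _ _ (nbhs (z : R[i]^o))) => e e0.
have e0' : 0 < e%:C%C :> R[i] by rewrite ltcR.
near=> w; have : ball (z : R[i]^o) e%:C%C w by near: w; exact: nbhsx_ballx.
rewrite /ball/= -ReB => /(le_lt_trans (normc_ge_Re _)).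
by rewrite ltcR.
Unshelve. all: by end_near. Qed.

Lemma continuous_Im : continuous (@complex.Im R : R[i]^o -> R).
Proof.
move=> z; apply/(@cvgrPdist_lt _ _ _ (nbhs (z : R[i]^o))) => e e0.
have e0' : 0 < e%:C%C :> R[i] by rewrite ltcR.
near=> w; have : ball (z : R[i]^o) e%:C%C w by near: w; exact: nbhsx_ballx.
rewrite /ball/= -ImB; case: (z - w) => x y /=.
rewrite normc_def ltcR/=; apply: le_lt_trans.
by rewrite -sqrtr_sqr ler_wsqrtr// lerDr sqr_ge0.
Unshelve. all: by end_near. Qed.

Section id_plus_beta.
Variables (beta : R[i] -> R[i]).
Hypothesis cbeta : continuous (beta : R[i]^o -> R[i]^o).
Hypothesis mbeta : strictly_monotone beta.

Lemma continuous_Re_comp :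
  continuous (fun p : R * R => complex.Re (beta (Complex p.1 p.2))).
Proof.
move=> p; apply: (@continuous_comp (R * R)%type R[i]^o R
  (fun p => beta (Complex p.1 p.2))); last exact: continuous_Re.
apply: (@continuous_comp (R * R)%type R[i]^o R[i]^o
  (fun p => Complex p.1 p.2)); last exact: cbeta.
exact: continuous_mkcomplex.
Qed.

Lemma continuous_Im_comp :
  continuous (fun p : R * R => complex.Im (beta (Complex p.1 p.2))).
Proof.
move=> p; apply: (@continuous_comp (R * R)%type R[i]^o R
  (fun p => beta (Complex p.1 p.2))); last exact: continuous_Im.
apply: (@continuous_comp (R * R)%type R[i]^o R[i]^o
  (fun p => Complex p.1 p.2)); last exact: cbeta.
exact: continuous_mkcomplex.
Qed.

Lemma id_plus_strictly_monotone_surj (w : R[i]) : exists z, z + beta z = w.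
Proof.
have [a a0 ma] := mbeta; case: w => w1 w2.
pose P x y := x + complex.Re (beta (Complex x y)).
pose Q x y := y + complex.Im (beta (Complex x y)).
(* The constant [1] is contributed by the identity; [beta] adds a nonnegative term. *)
have [| | | |x [y [Pxy Qxy]]] :=
    @strongly_monotone_plane_surj P Q 1 _ _ _ _ w1 w2; last first.
- exists (Complex x y); rewrite -Pxy -Qxy /P /Q.
  by case: (beta _).
- move=> x y x' y'; rewrite mul1r /P /Q.
  have := ma (Complex x y) (Complex x' y').
  rewrite Re_cdotE sqr_normc_ReIm !ReB !ImB/=.
  have : 0 <= a * ((x - x') ^+ 2 + (y - y') ^+ 2).
    by rewrite mulr_ge0 ?(ltW a0)// addr_ge0 ?sqr_ge0.
  nra.
- move=> p; apply: cvgD; last exact: continuous_Im_comp.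
  exact: cvg_snd.
- move=> p; apply: cvgD; last exact: continuous_Re_comp.
  exact: cvg_fst.
- exact: ltr01.
Qed.

(** Pairing the increment of [id + beta] with [z - w] gives at least the square of [|z - w|];
    Cauchy-Schwarz and division by [|z - w|] conclude. This makes the inverse of [id + beta]
    nonexpansive. *)
Lemma id_plus_strictly_monotone_expansive (z w : R[i]) :
  Normc.normc (z - w) <= Normc.normc ((z + beta z) - (w + beta w)).
Proof.
have [a a0 ma] := mbeta.
have [->|zw] := eqVneq (Normc.normc (z - w)) 0; first exact: normc_ge0.
have zw0 : 0 < Normc.normc (z - w) by rewrite lt_neqAle eq_sym zw normc_ge0.
rewrite -(ler_pM2r zw0) -expr2; apply: le_trans (Re_cdot_le _ _).
have := ma z w; rewrite !Re_cdotE sqr_normc_ReIm !ReB !ImB !ReD !ImD.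
set X := complex.Re z; set Y := complex.Im z.
set X' := complex.Re w; set Y' := complex.Im w.
have : 0 <= a * ((X - X') ^+ 2 + (Y - Y') ^+ 2).
  by rewrite mulr_ge0 ?(ltW a0)// addr_ge0 ?sqr_ge0.
nra.
Qed.

End id_plus_beta.
End strongly_monotone_maps.

(** * Scalar inequalities and geometric convergence *)

Lemma sqr_exprVn2 {R : numFieldType} k : (2^-1 ^+ k) ^+ 2 = (4 ^+ k)^-1 :> R.
Proof. by rewrite -exprM mulnC exprM -exprVn; congr (_ ^+ _); field. Qed.

(** Used for Cauchy-Schwarz and, in Riesz' theorem, to show that an almost minimizer is almost a
    critical point. *)
Lemma discriminant_le0 {R : realFieldType} (a b c : R) : 0 <= a ->
  (forall t, 0 <= a * t ^+ 2 + 2 * b * t + c) -> b ^+ 2 <= a * c.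
Proof.
rewrite le_eqVlt => /predU1P[<-|a0] h.
  have [->|b0] := eqVneq b 0; first by rewrite expr0n mul0r.
  (* With [a = 0] the polynomial is affine; this is the point where it equals [- 1]. *)
  have := h (- (c + 1) / (2 * b)).
  suff -> : 0 * (- (c + 1) / (2 * b)) ^+ 2 + 2 * b * (- (c + 1) / (2 * b)) + c =
    - 1 by lra.
  by field.
have := h (- b / a); rewrite -(ler_pM2l a0) mulr0.
suff -> : a * (a * (- b / a) ^+ 2 + 2 * b * (- b / a) + c) = a * c - b ^+ 2.
  by rewrite subr_ge0.
by field; rewrite gt_eqF.
Qed.

Lemma geometric_increments_cvg {R : realType} (u : nat -> R) (C : R) :
  (forall k, `|u k.+1 - u k| <= C * 2^-1 ^+ k) ->
  cvgn u /\ forall k, `|limn u - u k| <= 2 * C * 2^-1 ^+ k.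
Proof.
move=> du; have C0 : 0 <= C.
  by have := du 0; rewrite expr0 mulr1; apply: le_trans.
(* The bound is the exact partial sum of the geometric series, so the induction closes with an
   equality; the cruder [2 * C * 2^-1 ^+ k] would not be inductive. *)
have duD k n : `|u (k + n)%N - u k| <= 2 * C * (2^-1 ^+ k - 2^-1 ^+ (k + n)).
  elim: n => [|n IHn]; first by rewrite addn0 !subrr normr0 mulr0.
  rewrite addnS -(subrK (u (k + n)%N) (u (k + n).+1)) -addrA.
  rewrite (le_trans (ler_normD _ _))//.
  rewrite (le_trans (lerD (du _) IHn))// exprS.
  set a := _ ^+ (k + n); set b := _ ^+ k.
  by rewrite le_eqVlt; apply/orP; left; apply/eqP; field.
have ule k n : (k <= n)%N -> `|u n - u k| <= 2 * C * 2^-1 ^+ k.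
  move=> /subnKC <-; apply: le_trans (duD _ _) _.
  by rewrite ler_wpM2l ?mulr_ge0// gerBl exprn_ge0// invr_ge0.
have cu : cvgn u.
  apply: cauchy_cvg; apply: cauchy_exP => e e0.
  have /cvgrPdist_lt/(_ _ e0) : geometric (2 * C) 2^-1 @ \oo --> (0 : R).
    by apply: cvg_geometric; rewrite ger0_norm ?invr_ge0// invf_lt1// ltr1n.
  move=> [k _ /(_ k (leqnn k))]; rewrite /= sub0r normrN => ke.
  exists (u k); exists k => // n /= kn.
  rewrite /ball/= distrC (le_lt_trans (ule _ _ kn))//.
  by rewrite (le_lt_trans _ ke)// ler_norm.
split => // k.
have : (fun n => `|u n - u k|) @ \oo --> `|limn u - u k|.
  by apply: cvg_norm; apply: cvgB => //; exact: cvg_cst.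
move=> /cvgr_to_le; apply; exists k => // n /=; exact: ule.
Qed.

(** * Real square-integrable functions: completeness and Riesz' theorem *)

Section real_L2_space.
Context {d : measure_display} {T : measurableType d} {R : realType}.
Variables (mu : {measure set T -> \bar R}) (D : set T).
Hypothesis mD : measurable D.
Implicit Types f g h : T -> R.

Definition square_integrable f :=
  measurable_fun D f /\ (\int[mu]_(x in D) (f x ^+ 2)%:E < +oo)%E.

Definition real_L2_dot f g : R := \int[mu]_(x in D) (f x * g x).

Local Notation sqi := square_integrable.
Local Notation "''[' f , g ]" := (real_L2_dot f g) (format "''[' f ,  g ]").

Lemma integrable_sqr f : sqi f -> mu.-integrable D (fun x => (f x ^+ 2)%:E).
Proof.
move=> [mf foo]; apply/integrableP; split.
  by apply/measurable_EFinP; exact: measurable_funX.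
rewrite (eq_integral (fun x => (f x ^+ 2)%:E))// => x _.
by rewrite gee0_abs// lee_fin sqr_ge0.
Qed.

Lemma square_integrable_integrable f : measurable_fun D f ->
  mu.-integrable D (fun x => (f x ^+ 2)%:E) -> sqi f.
Proof.
move=> mf /integrableP[_ foo]; split => //; move: foo.
rewrite (eq_integral (fun x => (f x ^+ 2)%:E))// => x _.
by rewrite gee0_abs// lee_fin sqr_ge0.
Qed.

Lemma le_square_integrable f g : measurable_fun D f -> sqi g ->
  (forall x, D x -> `|f x| <= `|g x|) -> sqi f.
Proof.
move=> mf sg fg; apply: square_integrable_integrable => //.
apply: (le_integrable mD _ _ (integrable_sqr g sg)).
  by apply/measurable_EFinP; exact: measurable_funX.
by move=> x Dx; rewrite lee_fin !normrX ler_pXn2r ?nnegrE//; exact: fg.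
Qed.

Lemma integrable_mul f g : sqi f -> sqi g ->
  mu.-integrable D (fun x => (f x * g x)%:E).
Proof.
move=> sf sg; have [mf _] := sf; have [mg _] := sg.
apply: (le_integrable mD _ _
  (integrableD mD (integrable_sqr f sf) (integrable_sqr g sg))).
  by apply/measurable_EFinP; exact: measurable_funM.
move=> x Dx /=; rewrite lee_fin.
rewrite [leRHS]ger0_norm ?addr_ge0 ?sqr_ge0// normrM.
rewrite -(real_normK (num_real (f x))) -(real_normK (num_real (g x))).
have := sqr_ge0 (`|f x| - `|g x|).
have : 0 <= `|f x| * `|g x| by rewrite mulr_ge0.
lra.
Qed.

Lemma square_integrable_lin a f g : sqi f -> sqi g ->
  sqi (fun x => a * f x + g x).
Proof.
move=> sf sg; have [mf _] := sf; have [mg _] := sg.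
have m : measurable_fun D (fun x => a * f x + g x).
  by apply: measurable_funD => //; exact: measurable_funM.
apply: square_integrable_integrable => //.
rewrite (_ : (fun x => _) = (fun x => (a ^+ 2)%:E * (f x ^+ 2)%:E +
    ((2 * a)%:E * (f x * g x)%:E + (g x ^+ 2)%:E))%E); last first.
  by apply/funext => x; rewrite -!EFinM -!EFinD; congr EFin; ring.
apply: integrableD => //.
  by apply: integrableZl => //; exact: integrable_sqr.
apply: integrableD => //; last exact: integrable_sqr.
by apply: integrableZl => //; exact: integrable_mul.
Qed.

Lemma square_integrableB f g : sqi f -> sqi g -> sqi (fun x => f x - g x).
Proof.
move=> sf sg; rewrite (_ : (fun x => _) = fun x => -1 * g x + f x).
  exact: square_integrable_lin.
by apply/funext => x; rewrite mulN1r addrC.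
Qed.

Lemma square_integrableD f g : sqi f -> sqi g -> sqi (fun x => f x + g x).
Proof.
move=> sf sg; rewrite (_ : (fun x => _) = fun x => 1 * f x + g x).
  exact: square_integrable_lin.
by apply/funext => x; rewrite mul1r.
Qed.

Lemma square_integrable0 : sqi (cst 0).
Proof.
split; first exact: measurable_cst.
by rewrite integral0_eq//= => x _; rewrite expr0n.
Qed.

Lemma real_L2_dotC f g : '[f, g] = '[g, f].
Proof. by congr Rintegral; apply/funext => x; rewrite mulrC. Qed.

Lemma real_L2_dot_lin a f g h : sqi f -> sqi g -> sqi h ->
  '[(fun x => a * f x + g x), h] = a * '[f, h] + '[g, h].
Proof.
move=> sf sg sh; rewrite /real_L2_dot.
have ifh := integrable_mul f h sf sh.
have iafh : mu.-integrable D (EFin \o (fun x => a * (f x * h x))).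
  by apply: (integrableZl _ a ifh).
rewrite -RintegralZl// -RintegralD//; last exact: integrable_mul.
by congr Rintegral; apply/funext => x; rewrite mulrDl mulrA.
Qed.

Lemma real_L2_dotD f g h : sqi f -> sqi g -> sqi h ->
  '[(fun x => f x + g x), h] = '[f, h] + '[g, h].
Proof.
move=> sf sg sh; have := real_L2_dot_lin 1 f g h sf sg sh.
rewrite mul1r => <-; congr real_L2_dot.
by apply/funext => x; rewrite mul1r.
Qed.

Lemma real_L2_dotB f g h : sqi f -> sqi g -> sqi h ->
  '[(fun x => f x - g x), h] = '[f, h] - '[g, h].
Proof.
move=> sf sg sh; have := real_L2_dot_lin (-1) g f h sg sf sh.
rewrite mulN1r addrC => <-; congr real_L2_dot.
by apply/funext => x; rewrite mulN1r addrC.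
Qed.

Lemma real_L2_dot_ge0 f : 0 <= '[f, f].
Proof. by apply: Rintegral_ge0 => x _; rewrite -expr2 sqr_ge0. Qed.

Lemma EFin_real_L2_dot f : sqi f ->
  ('[f, f])%:E = (\int[mu]_(x in D) (f x ^+ 2)%:E)%E.
Proof.
move=> sf; rewrite fineK ?integrable_fin_num//; exact: integrable_mul.
Qed.

Lemma real_L2_dot_sqr_lin a f g : sqi f -> sqi g ->
  '[(fun x => a * f x + g x), (fun x => a * f x + g x)] =
  a ^+ 2 * '[f, f] + 2 * a * '[f, g] + '[g, g].
Proof.
move=> sf sg; have s := square_integrable_lin a f g sf sg.
rewrite real_L2_dot_lin// ![real_L2_dot _ (fun x => _ + _)]real_L2_dotC.
rewrite !real_L2_dot_lin// (real_L2_dotC g f); ring.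
Qed.

(** Discriminant of the nonnegative polynomial sending [t] to the squared norm of [t * f + g]. *)
Lemma real_L2_Cauchy_Schwarz f g : sqi f -> sqi g ->
  '[f, g] ^+ 2 <= '[f, f] * '[g, g].
Proof.
move=> sf sg; apply: discriminant_le0; first exact: real_L2_dot_ge0.
move=> t; have := real_L2_dot_ge0 (fun x => t * f x + g x).
rewrite real_L2_dot_sqr_lin// => /le_trans; apply.
by rewrite le_eqVlt; apply/orP; left; apply/eqP; ring.
Qed.

(* The weights [4 ^ k] keep [S = \sum_k 4 ^ k * (f k.+1 - f k) ^ 2] integrable,
   and where [S] is finite the sequence converges at speed [2 ^- k * sqrt S]. *)
Lemma real_L2_complete (f : nat -> T -> R) : (forall k, sqi (f k)) ->
  (forall k, '[(fun x => f k.+1 x - f k x), (fun x => f k.+1 x - f k x)]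
     <= 8^-1 ^+ k) ->
  exists2 g, sqi g &
    (fun k => '[(fun x => g x - f k x), (fun x => g x - f k x)]) @ \oo --> 0.
Proof.
move=> sf df.
pose h k x : \bar R := (4 ^+ k * (f k.+1 x - f k x) ^+ 2)%:E.
have sdf k : sqi (fun x => f k.+1 x - f k x) by exact: square_integrableB.
have h0 k x : (0 <= h k x)%E by rewrite lee_fin mulr_ge0 ?sqr_ge0 ?exprn_ge0.
have mh k : measurable_fun D (h k).
  apply/measurable_EFinP; apply: measurable_funM => //.
  by apply: measurable_funX; case: (sdf k).
pose S x : \bar R := (\sum_(0 <= k <oo) h k x)%E.
have mS : measurable_fun D S by exact: ge0_emeasurable_sum.
have S0 x : (0 <= S x)%E by exact: nneseries_ge0.
(* The rate [8^-1] beats the weight: the k-th integral is at most [4 ^+ k * 8^-1 ^+ k = 2^-1 ^+ k],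
   and these sum to 2. *)
have intS : (\int[mu]_(x in D) S x <= 2%:E)%E.
  rewrite integral_nneseries//.
  apply: le_trans (@epsilon_trick0 R 2 xpredT _) => //.
  apply: lee_nneseries => [k _ _|k _]; first exact: integral_ge0.
  under eq_integral do rewrite /h EFinM.
  rewrite ge0_integralZl//; last 2 first.
  - by apply/measurable_EFinP; apply: measurable_funX; case: (sdf k).
  - by move=> x _; rewrite lee_fin sqr_ge0.
  rewrite -EFin_real_L2_dot// -EFinM lee_fin.
  apply: le_trans (ler_wpM2l _ (df k)) _; first by rewrite exprn_ge0.
  rewrite natrX exprS invfM mulrA mulfV// mul1r -exprMn -exprVn.
  by rewrite (_ : 4 * 8^-1 = 2^-1 :> R)//; field.
(* Truncating to [0] where [S] is infinite makes the sequence converge at every point of [D], so its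
   limit is measurable. *)
pose c k x := if (S x < +oo)%E then f k x else 0.
have ccvg x : D x -> (S x < +oo)%E -> cvgn (fun k => f k x) /\ forall k,
    (((limn (fun k => f k x) - f k x) ^+ 2)%:E <= (4 * 4^-1 ^+ k)%:E * S x)%E.
  move=> Dx Sx; have Sfin : S x \is a fin_num by rewrite ge0_fin_numE.
  have [|cf lf] := geometric_increments_cvg (fun k => f k x)
    (Num.sqrt (fine (S x))).
    move=> k; rewrite -(@ler_pXn2r _ 2) ?nnegrE ?mulr_ge0 ?sqrtr_ge0 ?exprn_ge0//.
    rewrite real_normK ?num_real// exprMn sqr_sqrtr ?fine_ge0//.
    rewrite sqr_exprVn2 ler_pdivlMr ?exprn_gt0// mulrC.
    rewrite -lee_fin fineK//; apply: le_trans (nneseries_lim_ge k.+1 _) => //.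
    rewrite big_nat_recr//= leeDr//; exact: sume_ge0.
  split => // k; rewrite -(fineK Sfin) -EFinM lee_fin.
  have C0 : 0 <= 2 * Num.sqrt (fine (S x)) * 2^-1 ^+ k.
    by rewrite !mulr_ge0 ?sqrtr_ge0// exprn_ge0// invr_ge0.
  rewrite -real_normK ?num_real//.
  apply: (le_trans (lerXn2r 2 _ _ (lf k))); rewrite ?nnegrE//.
  rewrite !exprMn sqr_sqrtr ?fine_ge0// sqr_exprVn2 exprVn.
  by rewrite le_eqVlt; apply/orP; left; apply/eqP; ring.
pose g x := limn (fun k => c k x).
have gE x : (S x < +oo)%E -> g x = limn (fun k => f k x).
  by move=> Sx; rewrite /g /c Sx.
have mc k : measurable_fun D (c k).
  apply: measurable_fun_if => //.
    by apply: measurable_fun_lte => //; exact: measurable_cst.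
  by apply: (@measurable_funS _ _ _ _ D) => //; case: (sf k).
have mg : measurable_fun D g.
  apply: (@measurable_fun_cvg _ _ _ D c) => // x Dx.
  have [Sx|Sx] := boolP (S x < +oo)%E.
    have [cf _] := ccvg x Dx Sx; rewrite gE// (_ : (fun k => c k x) = f^~ x)//.
    by apply/funext => k; rewrite /c Sx.
  rewrite /g (_ : (fun k => c k x) = cst 0); last first.
    by apply/funext => k; rewrite /c (negbTE Sx).
  by rewrite lim_cst//; exact: cvg_cst.
(* Valid at every point of [D], since the right side is [+oo] where [S] is; the set where [S] is
   infinite needs no separate treatment. The constant is the square of [2 * 2^-1 ^+ k]. *)
have gf k x : D x ->
    (((g x - f k x) ^+ 2)%:E <= (4 * 4^-1 ^+ k)%:E * S x)%E.
  move=> Dx; have [Sx|Sx] := boolP (S x < +oo)%E.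
    by rewrite gE//; have [_ ->] := ccvg x Dx Sx.
  have /eqP-> : S x == +oo%E by rewrite -leye_eq leNgt.
  by rewrite gt0_muley ?leey// lte_fin mulr_gt0// exprn_gt0// invr_gt0.
have mgf k : measurable_fun D (fun x => g x - f k x).
  by apply: measurable_funB => //; case: (sf k).
have igf k : (\int[mu]_(x in D) ((g x - f k x) ^+ 2)%:E <=
    (8 * 4^-1 ^+ k)%:E)%E.
  have k0 : 0 <= 4 * 4^-1 ^+ k :> R by rewrite mulr_ge0 ?exprn_ge0 ?invr_ge0.
  apply: (@le_trans _ _ (\int[mu]_(x in D) ((4 * 4^-1 ^+ k)%:E * S x))%E).
    apply: ge0_le_integral => //.
    - by move=> x _; rewrite lee_fin sqr_ge0.
    - by apply/measurable_EFinP; exact: measurable_funX.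
    - by apply: emeasurable_funM => //; exact: measurable_cst.
    - by move=> x; exact: gf.
  rewrite ge0_integralZl//; apply: le_trans (lee_wpmul2l _ intS) _ => //.
  by rewrite -EFinM lee_fin le_eqVlt; apply/orP; left; apply/eqP; ring.
have sgf k : sqi (fun x => g x - f k x).
  by split => //; apply: le_lt_trans (igf k) _; rewrite ltry.
exists g.
  rewrite (_ : g = fun x => (g x - f 0 x) + f 0 x).
    exact: square_integrableD.
  by apply/funext => x; rewrite subrK.
apply: (@squeeze_cvgr _ _ _ _ (cst 0) (geometric 8 4^-1)).
- apply: nearW => k; rewrite real_L2_dot_ge0/=.
  by rewrite -lee_fin EFin_real_L2_dot.
- exact: cvg_cst.
- by apply: cvg_geometric; rewrite ger0_norm ?invr_ge0// invf_lt1// ltr1n.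
Qed.

(* The representative is the minimizer of [f |-> '[f, f] - 2 * L f];
   a minimizing sequence is Cauchy by the parallelogram identity. *)
Lemma real_L2_Riesz (L : (T -> R) -> R) (M : R) :
  (forall a f g, sqi f -> sqi g -> L (fun x => a * f x + g x) = a * L f + L g) ->
  (forall f, sqi f -> `|L f| <= M * Num.sqrt '[f, f]) ->
  exists2 g, sqi g & forall f, sqi f -> L f = '[g, f].
Proof.
move=> linL bndL.
pose Phi f := '[f, f] - 2 * L f.
pose A := [set Phi f | f in sqi].
have A0 : A !=set0.
  by exists (Phi (cst 0)); exists (cst 0) => //; exact: square_integrable0.
have lbA : has_lbound A.
  (* Completing the square: with [s] the norm of [f], [Phi f] is at least [s ^+ 2 - 2 * M * s]. *)
  exists (- M ^+ 2) => _ [f sf <-]; rewrite /Phi.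
  have := bndL f sf; rewrite ler_norml => /andP[_].
  have := sqr_sqrtr (real_L2_dot_ge0 f); have := sqr_ge0 (M - Num.sqrt '[f, f]).
  set s := Num.sqrt _; nra.
have hinf : has_inf A by split.
have PhiE a f g : sqi f -> sqi g -> Phi (fun x => a * f x + g x) =
    a ^+ 2 * '[f, f] + 2 * a * ('[f, g] - L f) + Phi g.
  by move=> sf sg; rewrite /Phi real_L2_dot_sqr_lin// linL//; ring.
(* Comparing [Phi] at the midpoint of [u k] and [u k.+1] with the infimum bounds their squared
   distance by [2 * (eps k + eps k.+1)], which is 9/16 of [8^-1 ^+ k]: within the rate that
   [real_L2_complete] asks for. *)
pose eps k : R := 8^-1 ^+ k / 4.
have eps0 k : 0 < eps k by rewrite divr_gt0// exprn_gt0// invr_gt0.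
have /choice[u uP] : forall k, exists f, sqi f /\ Phi f < inf A + eps k.
  move=> k; have [_ [f sf <-] Pf] := inf_adherent (eps0 k) hinf.
  by exists f.
have su k : sqi (u k) by have [] := uP k.
have infPhi f : sqi f -> inf A <= Phi f.
  by move=> sf; apply: ge_inf => //; exists f.
have du k : '[(fun x => u k.+1 x - u k x), (fun x => u k.+1 x - u k x)]
    <= 8^-1 ^+ k.
  pose w x := u k.+1 x - u k x.
  have sw : sqi w by exact: square_integrableB.
  have P1 : Phi (u k.+1) = '[w, w] + 2 * ('[w, u k] - L w) + Phi (u k).
    rewrite -[in LHS](_ : (fun x => 1 * w x + u k x) = u k.+1) ?PhiE//.
      by rewrite expr1n mul1r mulr1.
    by apply/funext => x; rewrite /w mul1r subrK.
  have := infPhi _ (square_integrable_lin 2^-1 w (u k) sw (su k)).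
  rewrite PhiE//.
  have [_] := uP k; have [_] := uP k.+1; rewrite P1 /eps exprS -/w.
  have : 0 <= 8^-1 ^+ k :> R by rewrite exprn_ge0// invr_ge0.
  move: (8^-1 ^+ k) => e; lra.
have [g sg ug] := real_L2_complete u su du.
exists g => // f sf; apply/esym/eqP.
rewrite -subr_eq0 -sqrf_eq0 eq_le sqr_ge0 andbT.
(* Approximate Euler-Lagrange equation: along the line through [u k] in direction [f], [Phi] cannot
   drop by more than [eps k], which bounds its derivative at [u k]. *)
have uL k : ('[f, u k] - L f) ^+ 2 <= '[f, f] * eps k.
  apply: discriminant_le0; first exact: real_L2_dot_ge0.
  move=> t; have := infPhi _ (square_integrable_lin t f (u k) sf (su k)).
  by rewrite PhiE//; have [_] := uP k; lra.
pose delta k := '[(fun x => g x - u k x), (fun x => g x - u k x)].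
have ineq k : ('[g, f] - L f) ^+ 2 <= 2 * '[f, f] * (delta k + eps k).
  have sgu := square_integrableB g (u k) sg (su k).
  have := real_L2_Cauchy_Schwarz _ _ sgu sf; have := uL k.
  rewrite real_L2_dotB// -/(delta k) (real_L2_dotC f (u k)).
  (* The square of [(x - y) + (y - L f)] is at most twice the sum of the squares; the hint is the
     exact defect. *)
  move: ('[g, f]) ('[u k, f]) => x y; have := sqr_ge0 (x - 2 * y + L f); nra.
have cv : (fun k => 2 * '[f, f] * (delta k + eps k)) @ \oo -->
    2 * '[f, f] * (0 + 0).
  apply: cvgM; first exact: cvg_cst.
  apply: cvgD => //; rewrite [eps](_ : _ = geometric 4^-1 8^-1).
    by apply: cvg_geometric; rewrite ger0_norm ?invr_ge0// invf_lt1// ltr1n.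
  by apply/funext => k; rewrite /eps mulrC.
rewrite addr0 mulr0 in cv.
by apply: (@cvgr_to_ge _ _ _ _ _ _ _ cv); exact: nearW.
Qed.


Lemma real_L2_dot_eq0 f : sqi f -> '[f, f] = 0 ->
  {ae mu, forall x, D x -> f x = 0}.
Proof.
move=> sf f0; have [mf _] := sf.
have mf2 : measurable_fun D (fun x => (f x ^+ 2)%:E).
  by apply/measurable_EFinP; exact: measurable_funX.
have /(ae_eq_integral_abs mu mD mf2) : (\int[mu]_(x in D) `|(f x ^+ 2)%:E| = 0)%E.
  transitivity ('[f, f])%:E; last by rewrite f0.
  rewrite EFin_real_L2_dot//; apply: eq_integral => x _.
  by rewrite gee0_abs// lee_fin sqr_ge0.
by apply: filterS => x fx Dx; apply/eqP; rewrite -sqrf_eq0; have /eqP := fx Dx.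
Qed.

Lemma ae_eq_real_L2_dot f g h : measurable_fun D f -> measurable_fun D g ->
  measurable_fun D h -> {ae mu, forall x, D x -> f x = g x} ->
  '[f, h] = '[g, h].
Proof.
move=> mf mg mh fg; congr fine; apply: ae_eq_integral => //.
- by apply/measurable_EFinP; exact: measurable_funM.
- by apply/measurable_EFinP; exact: measurable_funM.
- by apply: filterS fg => x fg Dx; rewrite fg.
Qed.

Lemma square_integrable_normr f : sqi f -> sqi (fun x => `|f x|).
Proof.
move=> sf; have [mf _] := sf; apply: le_square_integrable (sf) _ => [|x _].
  by apply: measurableT_comp => //; exact: measurable_normr.
by rewrite normr_id.
Qed.

Lemma square_integrable_cst (r : R) : (mu D < +oo)%E -> sqi (cst r).
Proof.
move=> muD; split; first exact: measurable_cst.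
rewrite (_ : (fun x => _) = cst (r ^+ 2)%:E)// integral_cst//.
by rewrite lte_mul_pinfty// lee_fin sqr_ge0.
Qed.

End real_L2_space.

(** * Complex [L2] through real and imaginary parts *)

Section complex_L2_space.
Context {R : realType} {n : nat} (O : set 'rV[R]_n).
Hypothesis oO : open O.
Local Notation mu := (lebesgue_rV n).
Local Notation fct := ('rV[R]_n -> R[i]).
Local Notation "'Re_ f" := (fun x => complex.Re (f x))
  (at level 10, f at level 8).
Local Notation "'Im_ f" := (fun x => complex.Im (f x))
  (at level 10, f at level 8).
Local Notation sqi := (square_integrable mu O).
Local Notation "''[' f , g ]" := (real_L2_dot mu O f g) (format "''[' f ,  g ]").
Implicit Types f g h : fct.

Let mO : measurable O := open_measurable_rV oO.

Lemma L2_ReIm f : L2 O f <-> sqi ('Re_ f) /\ sqi ('Im_ f).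
Proof.
split=> [[mr mi foo]|[sr si]].
  have mN : measurable_fun O (fun x => (Normc.normc (f x) ^+ 2)%:E).
    apply/measurable_EFinP; under eq_fun do rewrite sqr_normc_ReIm.
    by apply: measurable_funD; exact: measurable_funX.
  split; split => //; apply: le_lt_trans foo; apply: ge0_le_integral => //.
  - by move=> x _; rewrite lee_fin sqr_ge0.
  - by apply/measurable_EFinP; exact: measurable_funX.
  - by move=> x _; rewrite lee_fin sqr_normc_ReIm lerDl sqr_ge0.
  - by move=> x _; rewrite lee_fin sqr_ge0.
  - by apply/measurable_EFinP; exact: measurable_funX.
  - by move=> x _; rewrite lee_fin sqr_normc_ReIm lerDr sqr_ge0.
have [mr roo] := sr; have [mi ioo] := si; split => //.
under eq_integral do rewrite sqr_normc_ReIm EFinD.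
rewrite ge0_integralD//; first by rewrite lte_add_pinfty.
- by move=> x _; rewrite lee_fin sqr_ge0.
- by apply/measurable_EFinP; exact: measurable_funX.
- by move=> x _; rewrite lee_fin sqr_ge0.
- by apply/measurable_EFinP; exact: measurable_funX.
Qed.

Lemma L2D f g : L2 O f -> L2 O g -> L2 O (fun x => f x + g x).
Proof.
move=> /L2_ReIm[fr fi] /L2_ReIm[gr gi]; apply/L2_ReIm; split.
  by under eq_fun do rewrite ReD; exact: square_integrableD.
by under eq_fun do rewrite ImD; exact: square_integrableD.
Qed.

Lemma L2B f g : L2 O f -> L2 O g -> L2 O (fun x => f x - g x).
Proof.
move=> /L2_ReIm[fr fi] /L2_ReIm[gr gi]; apply/L2_ReIm; split.
  by under eq_fun do rewrite ReB; exact: square_integrableB.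
by under eq_fun do rewrite ImB; exact: square_integrableB.
Qed.

Lemma L2_dotE f g : L2 O f -> L2 O g -> L2_dot O f g =
  Complex ('['Re_ f, 'Re_ g] + '['Im_ f, 'Im_ g])
          ('['Re_ f, 'Im_ g] - '['Im_ f, 'Re_ g]).
Proof.
move=> /L2_ReIm[fr fi] /L2_ReIm[gr gi]; rewrite /L2_dot /cintegral.
under eq_Rintegral do rewrite Re_cdotE.
under [X in Complex _ X]eq_Rintegral do rewrite Im_cdotE.
by rewrite RintegralD ?RintegralB//; exact: integrable_mul.
Qed.

Lemma L2_dotDl f g h : L2 O f -> L2 O g -> L2 O h ->
  L2_dot O (fun x => f x + g x) h = L2_dot O f h + L2_dot O g h.
Proof.
move=> Lf Lg Lh; rewrite !L2_dotE//; last exact: L2D.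
move: Lf Lg Lh => /L2_ReIm[fr fi] /L2_ReIm[gr gi] /L2_ReIm[hr hi].
rewrite (_ : 'Re_ (_ + _) = fun x => complex.Re (f x) + complex.Re (g x)).
rewrite (_ : 'Im_ (_ + _) = fun x => complex.Im (f x) + complex.Im (g x)).
rewrite !real_L2_dotD//; congr Complex; ring.
by apply/funext => x; rewrite ImD.
by apply/funext => x; rewrite ReD.
Qed.

Lemma L2_dotBl f g h : L2 O f -> L2 O g -> L2 O h ->
  L2_dot O (fun x => f x - g x) h = L2_dot O f h - L2_dot O g h.
Proof.
move=> Lf Lg Lh; apply/esym/eqP; rewrite subr_eq -L2_dotDl//; last exact: L2B.
by apply/eqP; congr L2_dot; apply/funext => x; rewrite subrK.
Qed.

Lemma ae_eq_L2_dot f g h : L2 O f -> L2 O g -> L2 O h ->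
  {ae mu, forall x, O x -> f x = g x} -> L2_dot O f h = L2_dot O g h.
Proof.
move=> Lf Lg Lh fg; rewrite !L2_dotE//.
move: Lf Lg Lh => [fr fi _] [gr gi _] [hr hi _].
have fgr : {ae mu, forall x, O x -> ('Re_ f) x = ('Re_ g) x}.
  by apply: filterS fg => x fg /fg ->.
have fgi : {ae mu, forall x, O x -> ('Im_ f) x = ('Im_ g) x}.
  by apply: filterS fg => x fg /fg ->.
by congr Complex; congr (_ + _); rewrite ?(ae_eq_real_L2_dot mu O mO _ _ _ _ _ _ fgr)
  ?(ae_eq_real_L2_dot mu O mO _ _ _ _ _ _ fgi).
Qed.

Lemma L2_norm_sqrE f : L2 O f ->
  L2_norm O f ^+ 2 = '['Re_ f, 'Re_ f] + '['Im_ f, 'Im_ f].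
Proof.
move=> /L2_ReIm[fr fi]; rewrite /L2_norm sqr_sqrtr; last first.
  by apply: Rintegral_ge0 => x _; exact: sqr_ge0.
under eq_Rintegral do rewrite sqr_normc_ReIm !expr2.
by rewrite RintegralD//; exact: integrable_mul.
Qed.

Lemma Re_L2_dot_norm f : L2 O f -> complex.Re (L2_dot O f f) = L2_norm O f ^+ 2.
Proof. by move=> Lf; rewrite L2_dotE// L2_norm_sqrE. Qed.

Lemma L2_norm_eq0 f : L2 O f -> L2_norm O f ^+ 2 = 0 ->
  {ae mu, forall x, O x -> f x = 0}.
Proof.
move=> Lf; rewrite L2_norm_sqrE// => /eqP.
rewrite paddr_eq0 ?real_L2_dot_ge0// => /andP[/eqP r0 /eqP i0].
have [fr fi] := (L2_ReIm _).1 Lf.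
have := real_L2_dot_eq0 _ _ mO _ fr r0; have := real_L2_dot_eq0 _ _ mO _ fi i0.
apply: filterS2 => x fi0 fr0 Ox; have := fr0 Ox; have := fi0 Ox.
by case: (f x) => a b /= -> ->.
Qed.

Lemma L2_dot_dual f : L2 O f -> L2_dual O (L2_dot O f).
Proof.
move=> Lf; have [fr fi] := (L2_ReIm _).1 Lf; split=> [a g h Lg Lh|].
  have [gr gi] := (L2_ReIm _).1 Lg; have [hr hi] := (L2_ReIm _).1 Lh.
  case: a => a b.
  have reE : (fun x => complex.Re (Complex a b * g x + h x)) =
      fun x => a * complex.Re (g x) + (- b * complex.Im (g x) + complex.Re (h x)).
    by apply/funext => x; case: (g x) (h x) => [? ?] [? ?]/=; ring.
  have imE : (fun x => complex.Im (Complex a b * g x + h x)) =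
      fun x => a * complex.Im (g x) + (b * complex.Re (g x) + complex.Im (h x)).
    by apply/funext => x; case: (g x) (h x) => [? ?] [? ?]/=; ring.
  have sre := square_integrable_lin _ _ mO (- b) _ _ gi hr.
  have sim := square_integrable_lin _ _ mO b _ _ gr hi.
  rewrite !L2_dotE//; last first.
    by apply/L2_ReIm; rewrite reE imE; split; exact: square_integrable_lin.
  rewrite reE imE ![real_L2_dot _ _ (fun x => complex.Re (f x)) _]real_L2_dotC.
  rewrite ![real_L2_dot _ _ (fun x => complex.Im (f x)) _]real_L2_dotC.
  rewrite !real_L2_dot_lin//; simpc; congr Complex; ring.
(* One factor for each of the four real products in [L2_dotE]. *)
exists (4 * L2_norm O f) => g Lg; have [gr gi] := (L2_ReIm _).1 Lg.
have N0 h : 0 <= L2_norm O h by exact: sqrtr_ge0.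
have CS r s : sqi r -> sqi s -> '[r, r] <= L2_norm O f ^+ 2 ->
    '[s, s] <= L2_norm O g ^+ 2 -> `|'[r, s]| <= L2_norm O f * L2_norm O g.
  move=> sr ss rf sg; rewrite -(@ler_pXn2r _ 2) ?nnegrE ?mulr_ge0//.
  rewrite real_normK ?num_real// exprMn.
  apply: le_trans (real_L2_Cauchy_Schwarz _ _ mO _ _ sr ss) _.
  by apply: ler_pM => //; exact: real_L2_dot_ge0.
rewrite L2_dotE//; apply: le_trans (normc_le _) _ => /=.
have {}CS1 := CS _ _ fr gr; have {}CS2 := CS _ _ fi gi.
have {}CS3 := CS _ _ fr gi; have {}CS4 := CS _ _ fi gr.
move: CS1 CS2 CS3 CS4; rewrite !L2_norm_sqrE//.
rewrite !lerDl !lerDr !real_L2_dot_ge0 => /(_ isT isT) h1 /(_ isT isT) h2.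
move=> /(_ isT isT) h3 /(_ isT isT) h4.
rewrite (le_trans (lerD (ler_normD _ _) (ler_normB _ _)))//.
lra.
Qed.

(* The real functional Re v and the opposite of Im v, restricted to real
   functions, are represented by the real and imaginary parts of f. *)
Lemma L2_Riesz v : L2_dual O v -> exists2 f, L2 O f &
  forall g, L2 O g -> v g = L2_dot O f g.
Proof.
move=> [linv [M bndv]].
pose c (r : 'rV[R]_n -> R) : fct := fun x => Complex (r x) 0.
have Lc r : sqi r -> L2 O (c r).
  by move=> sr; apply/L2_ReIm; split => //; exact: square_integrable0.
have vc a r s : sqi r -> sqi s ->
    v (c (fun x => a * r x + s x)) = a%:C%C * v (c r) + v (c s).
  move=> sr ss; rewrite -linv; [|exact: Lc|exact: Lc].
  by congr v; apply/funext => x; rewrite /c; simpc.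
have bc r : sqi r -> Normc.normc (v (c r)) <= M * Num.sqrt '[r, r].
  move=> sr; apply: le_trans (bndv _ (Lc _ sr)) _.
  rewrite le_eqVlt; apply/orP; left; apply/eqP; congr (_ * Num.sqrt _).
  by apply: eq_Rintegral => x _; rewrite sqr_normc_ReIm/= expr0n addr0 expr2.
have [||a sa va] := real_L2_Riesz mu O mO (fun r => complex.Re (v (c r))) M.
- move=> t r s sr ss; rewrite vc//.
  by case: (v (c r)) (v (c s)) => [? ?] [? ?] /=; rewrite mul0r subr0.
- by move=> r sr; exact: le_trans (normr_Re_le_normc _) (bc r sr).
(* The minus sign reflects conjugation in the first argument: for real [r], the product of [a + i b]
   with [r] has imaginary part [- '[b, r]]. *)
have [||b sb vb] := real_L2_Riesz mu O mO (fun r => - complex.Im (v (c r))) M.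
- move=> t r s sr ss; rewrite vc//; case: (v (c r)) (v (c s)) => [? ?] [? ?] /=.
  by rewrite mul0r addr0 opprD mulrN.
- by move=> r sr; rewrite normrN; exact: le_trans (normr_Im_le_normc _) (bc r sr).
exists (fun x => Complex (a x) (b x)); first exact/L2_ReIm.
move=> g Lg; have [gr gi] := (L2_ReIm _).1 Lg.
(* Complex linearity determines [v] by its values on real functions. *)
have -> : v g = Complex 0 1 * v (c ('Im_ g)) + v (c ('Re_ g)).
  rewrite -linv; [|exact: Lc|exact: Lc].
  by congr v; apply/funext => x; rewrite /c; case: (g x) => p q; simpc.
rewrite L2_dotE//; last exact/L2_ReIm.
rewrite -!va// -!vb//; case: (v _) (v _) => [p q] [p' q'].
by simpc; congr Complex; rewrite addrC.
Qed.

End complex_L2_space.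

(** * Superposition operators on a bounded open set *)

Lemma continuous_measurable_rV {R : realType} n (g : 'rV[R]_n -> R) :
  continuous g -> measurable_fun setT g.
Proof.
move=> cg; apply: (measurability _ (RGenOpens.measurableE R)).
move=> _ [_ [a [b ->]] <-]; rewrite setTI; apply: open_measurable_rV.
by move/continuousP : cg; apply; exact: interval_open.
Qed.

(** Finite measure makes constants square-integrable, which the constant term of a linear growth
    bound requires. *)
Lemma bounded_lebesgue_rV_lty {R : realType} n (O : set 'rV[R]_n) :
  open O -> bounded_set O -> (lebesgue_rV n O < +oo)%E.
Proof.
move=> oO [M0 [_ /(_ (M0 + 1))]].
rewrite ltrDl ltr01 => /(_ isT); set M := M0 + 1 => OM.
(* [M] may be negative when [O] is empty; the absolute value keeps the edges of the box ordered. *)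
pose a : 'rV[R]_n := const_mx (- `|M|); pose b : 'rV[R]_n := const_mx `|M|.
pose B := [set x : 'rV[R]_n | forall i, x ord0 i \in `[a ord0 i, b ord0 i]].
have ab i : a ord0 i <= b ord0 i by rewrite !mxE ge0_cp.
have mB : measurable B.
  rewrite (_ : B = \bigcap_(i in [set: 'I_n])
      ((fun x : 'rV[R]_n => x ord0 i) @^-1` `[a ord0 i, b ord0 i])).
    apply: fin_bigcap_measurable => // i _.
    by rewrite -[X in measurable X]setTI; exact: measurable_coord.
  by apply/seteqP; split => x /= h i; [move=> _; exact: h|exact: (h i)].
apply: (@le_lt_trans _ _ (lebesgue_rV n B)); last first.
  by rewrite lebesgue_rV_box// ltry.
apply: le_measure; rewrite ?inE//; first exact: open_measurable_rV.
move=> x Ox i; rewrite !mxE in_itv/= -ler_norml.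
apply: le_trans (le_trans (OM x Ox) (ler_norm M)).
rewrite [leRHS]/Num.norm/= mx_normrE.
exact: (le_bigmax _ (fun ij => `|x ij.1 ij.2|) (ord0, i)).
Qed.

Section superposition.
Context {R : realType} {n : nat} (O : set 'rV[R]_n).
Hypothesis oO : open O.
Local Notation mu := (lebesgue_rV n).

Let mO : measurable O := open_measurable_rV oO.

(** The two parts, extended by zero outside [O], are bundled into a measurable map to ['rV[R]_2],
    where open sets, hence continuous functions, are already known to be measurable. *)
Lemma measurable_fun_comp_complex (P : R * R -> R) (f : 'rV[R]_n -> R[i]) :
  continuous P ->
  measurable_fun O (fun x => complex.Re (f x)) ->
  measurable_fun O (fun x => complex.Im (f x)) ->
  measurable_fun O (fun x => P (complex.Re (f x), complex.Im (f x))).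
Proof.
move=> cP /(measurable_restrictT _ mO) mr /(measurable_restrictT _ mO) mi.
pose r := (fun x => complex.Re (f x)) \_ O.
pose s := (fun x => complex.Im (f x)) \_ O.
pose H (x : 'rV[R]_n) : 'rV[R]_2 := \row_i (if i == ord0 then r x else s x).
pose Q (y : 'rV[R]_2) := P (y ord0 ord0, y ord0 ord_max).
have mH : measurable_fun setT H.
  apply: measurable_fun_rVP => i.
  rewrite (_ : (fun _ => _) = if i == ord0 then r else s); first by case: ifP.
  by apply/funext => x; rewrite mxE; case: ifP.
have mQ : measurable_fun setT Q.
  apply: continuous_measurable_rV => y.
  apply: (@continuous_comp _ _ _
    (fun y : 'rV[R]_2 => (y ord0 ord0, y ord0 ord_max)) P); last exact: cP.
  exact: (cvg_pair (@coord_continuous _ _ _ ord0 ord0 y)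
    (@coord_continuous _ _ _ ord0 ord_max y)).
apply: (@eq_measurable_fun _ _ _ _ O (Q \o H)).
  by move=> x xO; rewrite /Q /H /= !mxE/= /r /s !patchE xO.
by apply: measurable_funTS; exact: measurableT_comp.
Qed.

(** Applied both to [beta] and to the inverse of [id + beta]. *)
Lemma L2_superposition (b : R[i] -> R[i]) (f : 'rV[R]_n -> R[i]) :
  (mu O < +oo)%E -> continuous (b : R[i]^o -> R[i]^o) -> linear_growth b ->
  L2 O f -> L2 O (fun x => b (f x)).
Proof.
move=> Ooo cb [c c0 bc] Lf.
have [fr fi] := (L2_ReIm O oO f).1 Lf; have [mr _] := fr; have [mi _] := fi.
pose G x := c * (`|complex.Re (f x)| + `|complex.Im (f x)|) + c.
have sG : square_integrable mu O G.
  apply: square_integrable_lin => //; last exact: square_integrable_cst.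
  by apply: square_integrableD => //; exact: square_integrable_normr.
have bG x : Normc.normc (b (f x)) <= `|G x|.
  apply: le_trans (ler_norm _); apply: le_trans (bc _) _.
  by rewrite mulrDr mulr1 addrC lerD2r ler_wpM2l// normc_le.
have fE x : f x = Complex (complex.Re (f x)) (complex.Im (f x)) by case: (f x).
apply/(L2_ReIm O oO); split; apply: (le_square_integrable mu O mO _ G) => //.
- under eq_fun do rewrite fE.
  exact: (measurable_fun_comp_complex _ _ (continuous_Re_comp b cb)).
- by move=> x _; exact: le_trans (normr_Re_le_normc _) (bG x).
- under eq_fun do rewrite fE.
  exact: (measurable_fun_comp_complex _ _ (continuous_Im_comp b cb)).
- by move=> x _; exact: le_trans (normr_Im_le_normc _) (bG x).
Qed.

End superposition.

Lemma nonexpansive_continuous {R : realType} (b : R[i] -> R[i]) :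
  (forall z w, Normc.normc (b z - b w) <= Normc.normc (z - w)) ->
  continuous (b : R[i]^o -> R[i]^o).
Proof.
move=> bL z; apply/(@cvgrPdist_lt _ _ _ (nbhs (z : R[i]^o))) => e e0.
near=> w; have : ball (z : R[i]^o) e w by near: w; exact: nbhsx_ballx.
by apply: le_lt_trans; rewrite lecR.
Unshelve. all: by end_near. Qed.

Theorem proposition7 (R : realType) (n : nat) (O : set 'rV[R]_n)
    (beta : R[i] -> R[i])
    (J : ('rV[R]_n -> R[i]) -> ('rV[R]_n -> R[i]) -> R[i]) :
  open O -> bounded_set O ->
  strictly_monotone beta -> linear_growth beta ->
  continuous (beta : R[i]^o -> R[i]^o) ->
  extended_neg_laplacian O J ->
  let A := fun phi psi => - J (fun x => beta (phi x)) psi in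
  (forall v, L2_dual O v ->
     exists2 u, L2 O u & forall psi, L2 O psi -> J u psi - A u psi = v psi) /\
  maximal_monotone O (fun phi psi => - A phi psi).
Proof.
move=> oO bO mbeta lbeta cbeta [_ J_L2] A.
have Ooo := bounded_lebesgue_rV_lty n O oO bO.
have Lbeta f : L2 O f -> L2 O (fun x => beta (f x)).
  exact: L2_superposition.
have JE f psi : L2 O f -> L2 O psi -> J f psi = L2_dot O f psi by exact: J_L2.
have NAE f psi : L2 O f -> L2 O psi ->
    - A f psi = L2_dot O (fun x => beta (f x)) psi.
  by move=> Lf Lpsi; rewrite /A opprK JE//; exact: Lbeta.
have /choice[G GK] := id_plus_strictly_monotone_surj beta cbeta mbeta.
have G_le z w : Normc.normc (G z - G w) <= Normc.normc (z - w).
  by rewrite -{2}(GK z) -{2}(GK w); exact: id_plus_strictly_monotone_expansive.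
have LG f : L2 O f -> L2 O (fun x => G (f x)).
  apply: L2_superposition => //; first exact: nonexpansive_continuous.
  (* Nonexpansiveness gives [|G z| <= |z| + |G 0|], below [(1 + |G 0|) * (1 + |z|)]. *)
  exists (1 + Normc.normc (G 0)); first by rewrite addr_ge0// normc_ge0.
  move=> z; have := G_le z 0; rewrite subr0.
  have := le_normcD (G z - G 0) (G 0); rewrite subrK.
  have := normc_ge0 z; have := normc_ge0 (G 0); nra.
have solve f : L2 O f ->
    exists2 u, L2 O u & forall x, u x + beta (u x) = f x.
  by move=> Lf; exists (fun x => G (f x)); [exact: LG|move=> x; exact: GK].
split=> [v /(L2_Riesz O oO)[f Lf vE]|].
  have [u Lu uf] := solve f Lf; exists u => // psi Lpsi.
  rewrite NAE// JE// -L2_dotDl//; last exact: Lbeta.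
  by rewrite vE//; congr L2_dot; apply/funext.
split.
  exists 0; first exact: lexx.
  move=> p q [Lp _ pE] [Lq _ qE]; cbv zeta; rewrite mul0r.
  set h := fun x => p.1 x - q.1 x; have Lh : L2 O h by exact: L2B.
  rewrite pE// qE// !NAE// -L2_dotBl//; [|exact: Lbeta|exact: Lbeta].
  apply: Rintegral_ge0 => x _; have [a a0 ma] := mbeta.
  by apply: le_trans (ma _ _); rewrite mulr_ge0 ?sqr_ge0// ltW.
(* Strictness of the inclusion is refuted by showing that [T] lies in the graph. *)
move=> T TL2 [a a0 mT] [GT TG]; apply: TG => -[phi v] Tp.
have [/= Lphi dv] := TL2 _ Tp; split => //= psi Lpsi; rewrite NAE//.
have [fv Lfv vE] := L2_Riesz O oO v dv.
have [u Lu uE] := solve _ (L2D O oO _ _ Lfv Lphi).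
have Lbu := Lbeta _ Lu; have Lbphi := Lbeta _ Lphi.
have Tq : T (u, L2_dot O (fun x => beta (u x))).
  apply: GT; split => //=; first exact: L2_dot_dual.
  by move=> eta Leta; rewrite NAE.
have Lh := L2B O oO _ _ Lphi Lu.
have h0 : L2_norm O (fun x => phi x - u x) ^+ 2 = 0.
  apply/eqP; rewrite eq_le sqr_ge0 andbT.
  have := mT _ _ Tp Tq; rewrite /= vE//.
  set h := fun x => phi x - u x.
  (* By the choice of [u], [fv - beta u = u - phi = - h], so monotonicity of [T] bounds [a] times
     the squared norm of [h] by minus that squared norm. *)
  have -> : L2_dot O fv h - L2_dot O (fun x => beta (u x)) h = - L2_dot O h h.
    have := congr1 (fun f => L2_dot O f h) (funext uE).
    have -> : L2_dot O h h = L2_dot O phi h - L2_dot O u h by exact: L2_dotBl.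
    rewrite !L2_dotDl// => /eqP; rewrite -[_ == _]subr_eq0 => /eqP uE0.
    by apply/eqP; rewrite -subr_eq0 -oppr_eq0 -uE0; apply/eqP; ring.
  rewrite -[- L2_dot O h h]sub0r ReB Re_L2_dot_norm//= sub0r.
  have := sqr_ge0 (L2_norm O h); nra.
(* [operator_graph] compares functionals only, so [fv = beta phi] is needed almost everywhere
   only. *)
rewrite vE//; apply: ae_eq_L2_dot => //.
apply: filterS (L2_norm_eq0 O oO _ Lh h0) => x + Ox => /(_ Ox)/eqP.
rewrite subr_eq0 => /eqP phiu; apply: (addIr (u x)).
by rewrite -{1}phiu -uE phiu addrC.
Qed.
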